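(* Let $G$ be a group and let $\mathcal{I}$ be an ideal on the ring $2^G$. Then the set operator $\zeta:2^G\to 2^G$ defined by $\zeta(A)=A\cup A^{\propto}$ satisfies Kuratowski's closure axioms, i.e. $\zeta(\varnothing)=\varnothing$, $A\subseteq\zeta(A)$, $\zeta(A\cup B)=\zeta(A)\cup\zeta(B)$ and $\zeta(\zeta(A))=\zeta(A)$ for all $A,B\subseteq G$.
   Context: For a group $G$, $2^G$ denotes the power set of $G$, viewed as the ring $(2^G,\Delta,\cap)$ with $\Delta$ the symmetric difference as addition and $\cap$ as multiplication. An ideal $\mathcal{I}$ on $G$ (equivalently on $2^G$) is an ideal of this ring; equivalently, a nonempty family of subsets of $G$ closed under taking subsets and under finite unions. For $g\in G$ let $\mathcal{G}(g)$ be the set of all subgroups $H$ of $G$ with $g\in H$. For $A\subseteq G$, $A^{\propto}=A^{\propto}(\mathcal{I})=\{g\in G: H\cap A\notin\mathcal{I}\text{ for all }H\in\mathcal{G}(g)\}$. *)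

(* Defs.v *)
From mathcomp Require Import all_boot all_classical.

Set Implicit Arguments.
Unset Strict Implicit.
Unset Printing Implicit Defensive.

Local Open Scope classical_set_scope.

(* Ideal of the commutative ring (set T, `+`, `&`), where `+` is symmetric
   difference; closure under negation is automatic because A `+` A = set0.
   The ideal is not required to be proper. *)
Definition set_ideal (T : Type) (I : set (set T)) : Prop :=
  [/\ I set0,
      forall A B, I A -> I B -> I (A `+` B) &
      forall A B, I A -> I (B `&` A)].

Lemma set_idealP (T : Type) (I : set (set T)) :
  set_ideal I <->
  [/\ I !=set0,
      forall A B, B `<=` A -> I A -> I B &
      forall A B, I A -> I B -> I (A `|` B)].
Proof.
split=> -[I0 IY II].
  have IS A B : B `<=` A -> I A -> I B.
    by move=> /setIidPl <-; exact: II.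
  split=> //; first by exists set0.
  move=> A B IA IB.
  suff -> : A `|` B = A `+` (B `\` A) by apply: IY => //; apply: IS IB => x [].
  by apply/seteqP; split=> x /=; have [|] := pselect (A x); tauto.
case: I0 => C IC; split; first exact: IY IC.
  by move=> A B IA IB; apply: IY (II _ _ IA IB) => x [[]|[]]; [left|right].
by move=> A B; apply: IY => x [].
Qed.

Definition subgroups_containing (G : groupType) (g : G) : set (set G) :=
  [set H : set G | group_closed (mem H) /\ H g].

Definition propto (G : groupType) (I : set (set G)) (A : set G) : set G :=
  [set g | forall H, subgroups_containing g H -> ~ I (H `&` A)].

Definition zeta (G : groupType) (I : set (set G)) (A : set G) : set G :=
  A `|` propto I A.

Definition kuratowski_closure (T : Type) (c : set T -> set T) : Prop :=
  [/\ c set0 = set0,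
      forall A, A `<=` c A,
      forall A B, c (A `|` B) = c A `|` c B &
      forall A, c (c A) = c A].

(* Main.v *)
Require Import Defs.
From mathcomp Require Import all_boot all_classical.

Set Implicit Arguments.
Unset Strict Implicit.
Unset Printing Implicit Defensive.

Local Open Scope classical_set_scope.

(** The subgroups containing [g] play the role of neighbourhoods of [g], and
    [propto I A] is the local function of [A] in the sense of Kuratowski: the
    points all of whose neighbourhoods meet [A] in a set outside [I].  Two
    properties of neighbourhoods carry the proof.  They are stable under binary
    intersection, so small neighbourhoods for [A] and for [B] yield one for
    [A `|` B]: this is additivity ([proptoU]).  And a subgroup is a
    neighbourhood of each of its elements, so if some [H] makes [H `&` A] small
    then no point of [H] lies in [propto I A]: this gives
    [propto I (propto I A) `<=` propto I A] ([propto_propto]).  Idempotence of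
    [zeta I] follows formally from these two facts. *)

Lemma subgroups_containingI (G : groupType) (g : G) (H K : set G) :
  subgroups_containing g H -> subgroups_containing g K ->
  subgroups_containing g (H `&` K).
Proof.
move=> [[H1 HV] Hg] [[K1 KV] Kg]; split; last by split.
split; first by rewrite in_setI; apply/andP.
move=> x y; rewrite !in_setI => /andP[Hx Kx] /andP[Hy Ky].
by apply/andP; split; [exact: HV|exact: KV].
Qed.

(** Upper bounds on [propto] are proved by contraposition in this form, where
    the task becomes to exhibit a single subgroup. *)
Lemma not_propto (G : groupType) (I : set (set G)) (A : set G) (g : G) :
  ~ propto I A g <-> exists2 H, subgroups_containing g H & I (H `&` A).
Proof.
split=> [|[H gH IHA] /(_ H gH)//].
move=> nA; apply: contrapT => noH; apply: nA => H gH IHA.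
by apply: noH; exists H.
Qed.

Section LocalFunction.
Variables (G : groupType) (I : set (set G)).
Hypothesis hI : set_ideal I.
Implicit Types A B : set G.

Let I0 : I set0. Proof. by case: hI. Qed.

Let IS A B : B `<=` A -> I A -> I B.
Proof. by case/set_idealP: hI => _ + _; exact. Qed.

Let IU A B : I A -> I B -> I (A `|` B).
Proof. by case/set_idealP: hI => _ _; exact. Qed.

(** The witness is the whole group, whose trace on [set0] is in every ideal. *)
Lemma propto0 : propto I set0 = set0.
Proof.
apply/seteqP; split=> // g; apply/not_propto; exists setT; last by rewrite setI0.
by split=> //; split=> [|x y _ _]; rewrite in_setT.
Qed.

Lemma propto_subset A B : A `<=` B -> propto I A `<=` propto I B.
Proof.
by move=> AB g gA H gH IHB; apply: (gA H gH); apply: IS IHB; exact: setIS.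
Qed.

(** If [H] witnesses that [g] is not in [propto I A] and [K] that it is not in
    [propto I B], then [H `&` K] witnesses that it is not in
    [propto I (A `|` B)]. *)
Lemma proptoU A B : propto I (A `|` B) = propto I A `|` propto I B.
Proof.
apply/seteqP; split; last first.
  by move=> g [] ; apply: propto_subset => x; [left|right].
move=> g; apply: contraPP => /not_orP[/not_propto[H gH IHA] /not_propto[K gK IKB]].
apply/not_propto; exists (H `&` K); first exact: subgroups_containingI.
by apply: IS (IU IHA IKB) => x [[Hx Kx] [Ax|Bx]]; [left|right].
Qed.

(** A subgroup [H] with [H `&` A] in [I] excludes all its elements, not only
    [g], from [propto I A]; its trace on [propto I A] is thus empty. *)
Lemma propto_propto A : propto I (propto I A) `<=` propto I A.
Proof.
move=> g; apply: contraPP => /not_propto[H gH IHA].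
apply/not_propto; exists H => //.
apply: IS I0 => x [Hx /(_ H)]; case: gH => closedH _.
by apply.
Qed.

End LocalFunction.

Theorem lemma2p20 (G : groupType) (I : set (set G)) (hI : set_ideal I) :
  kuratowski_closure (zeta I).
Proof.
rewrite /zeta; split.
- by rewrite propto0// setU0.
- by move=> A; exact: subsetUl.
- by move=> A B; rewrite proptoU// setUACA.
- move=> A; rewrite proptoU//; apply/setUidPl => g [gA|gA]; right=> //.
  exact: (propto_propto hI).
Qed.
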